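(* If $(b_{n})|_{n=\infty}$ is a contiguous arrangement of $(a_{n})|_{n=\infty}$ and $\sum a_{n}|_{n=\infty}$ is a monotonic convergence sum, then $$\sum a_{n} = \sum b_{n}|_{n=\infty}.$$
   Context: A contiguous (sum) rearrangement constructs another sum by bracketing sequential terms without changing their order: a function $\tau$ from integers to integers with $\tau(n)\ge 1$ and $\tau(n+1)-\tau(n)\ge 1$ partitions $(a_n)$ into consecutive blocks $(a_{\tau(n)},a_{\tau(n)+1},\ldots,a_{\tau(n+1)-1})$, and the terms of the rearranged sum are $b_n=a_{\tau(n)}+a_{\tau(n)+1}+\cdots+a_{\tau(n+1)-1}$. The sum $\sum a_n$ is called monotonic when its sequence of partial sums is monotonic. ''$|_{n=\infty}$'' means that sequences and sums are considered at infinite indices, in an ordered number system extending $\mathbb{R}$ with infinitesimals and infinities (comparable with the hyperreals). A convergence sum $\sum a_n|_{n=\infty}$ is a sum over infinite indices; it takes (after realizing infinitesimals as $0$ and infinities as $\infty$) the value $0$ when the sum converges and $\infty$ when it diverges. The displayed equality means that both sums have the same value, i.e. both converge or both diverge. *)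

(* Defs.v *)
From HB Require Import structures.
From mathcomp Require Import all_boot all_order all_algebra.
From mathcomp Require Import all_classical all_reals all_analysis.

Set Implicit Arguments.
Unset Strict Implicit.
Unset Printing Implicit Defensive.

Import Order.TTheory GRing.Theory Num.Theory.
Import numFieldNormedType.Exports.

Local Open Scope classical_set_scope.
Local Open Scope ring_scope.
Local Open Scope quotient_scope.

(* The number system containing infinitesimals and infinities is the
   ultrapower along a non-principal ultrafilter on nat: [hyper U R] are the
   hyperreals, [hyper U nat] the hypernaturals. *)

Record free_ultrafilter := FreeUltrafilter {
  ultra_sets :> set_system nat ;
  ultraP : UltraFilter ultra_sets ;
  ultra_free : \oo `<=` ultra_sets }.

#[global] Instance ultra_proper (U : free_ultrafilter) : ProperFilter U.
Proof. by case: U => U []. Qed.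

Lemma exists_free_ultrafilter : exists U : free_ultrafilter, True.
Proof.
have [U [UU le_ooU]] := @ultraFilterLemma nat \oo _.
by exists (FreeUltrafilter UU le_ooU).
Qed.

Section Ultrapower.
Context (U : free_ultrafilter).

Section Quotient.
Context (T : choiceType).

Definition hyper_eq : rel (nat -> T) := fun f g =>
  `[< \forall i \near ultra_sets U, f i = g i >].

Lemma hyper_eq_refl : reflexive hyper_eq.
Proof. by move=> f; apply/asboolP; near=> i. Unshelve. all: by end_near. Qed.

Lemma hyper_eq_sym : symmetric hyper_eq.
Proof.
by move=> f g; apply/idP/idP => /asboolP fg; apply/asboolP; apply: filterS fg.
Qed.

Lemma hyper_eq_trans : transitive hyper_eq.
Proof.
move=> g f h /asboolP fg /asboolP gh; apply/asboolP.
by apply: filterS2 fg gh => i -> ->.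
Qed.

Canonical hyper_equiv :=
  EquivRel hyper_eq hyper_eq_refl hyper_eq_sym hyper_eq_trans.
Canonical hyper_encModRel :=  defaultEncModRel hyper_eq.

Definition hyper := {eq_quot hyper_eq}.

Definition hclass (f : nat -> T) : hyper := \pi_({eq_quot hyper_eq}) f.

Definition hrepr (x : hyper) : nat -> T := repr x.

Definition std (c : T) : hyper := hclass (fun=> c).

Lemma hclass_eqP (f g : nat -> T) :
  hclass f = hclass g <-> \forall i \near ultra_sets U, f i = g i.
Proof. by split=> [/eqmodP/asboolP|fg]; [|apply/eqmodP/asboolP]. Qed.

Lemma hreprK (x : hyper) : hclass (hrepr x) = x.
Proof. exact: reprK. Qed.

Lemma hrepr_class (f : nat -> T) : \forall i \near ultra_sets U, hrepr (hclass f) i = f i.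
Proof. by apply/hclass_eqP; rewrite hreprK. Qed.

End Quotient.

(* Natural (star) extensions of functions and relations. *)

Definition hmap (A B : choiceType) (f : A -> B) (x : hyper A) : hyper B :=
  hclass (fun i => f (hrepr x i)).

Definition hmap2 (A B C : choiceType) (f : A -> B -> C) (x : hyper A) (y : hyper B) :
  hyper C := hclass (fun i => f (hrepr x i) (hrepr y i)).

Definition hrel (A B : choiceType) (r : A -> B -> Prop) (x : hyper A) (y : hyper B) :
  Prop := \forall i \near ultra_sets U, r (hrepr x i) (hrepr y i).

Lemma hmapE (A B : choiceType) (f : A -> B) (u : nat -> A) :
  hmap f (hclass u) = hclass (f \o u).
Proof. by apply/hclass_eqP; apply: filterS (hrepr_class u) => i /= ->. Qed.

Lemma hmap2E (A B C : choiceType) (f : A -> B -> C) (u : nat -> A) (v : nat -> B) :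
  hmap2 f (hclass u) (hclass v) = hclass (fun i => f (u i) (v i)).
Proof.
by apply/hclass_eqP; apply: filterS2 (hrepr_class u) (hrepr_class v) => i -> ->.
Qed.

Lemma hrelE (A B : choiceType) (r : A -> B -> Prop) (u : nat -> A) (v : nat -> B) :
  hrel r (hclass u) (hclass v) <-> \forall i \near ultra_sets U, r (u i) (v i).
Proof.
split; first by apply: filterS3 (hrepr_class u) (hrepr_class v) => i -> ->.
by apply: filterS3 (hrepr_class u) (hrepr_class v) => i -> ->.
Qed.

Definition hleqn : hyper nat -> hyper nat -> Prop := hrel (fun m n => (m <= n)%N).
Definition hltn : hyper nat -> hyper nat -> Prop := hrel (fun m n => (m < n)%N).
Definition hsucc : hyper nat -> hyper nat := hmap S.

Definition infinite_index (N : hyper nat) : Prop := forall k : nat, hleqn (std k) N.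

Lemma infinite_index_exists : exists N, infinite_index N.
Proof.
exists (hclass id) => k; apply/hrelE; apply: (@ultra_free U).
exact: nbhs_infty_ge.
Qed.

Section Reals.
Context (R : realType).
Implicit Types a b : nat -> R.

Definition hle : hyper R -> hyper R -> Prop := hrel (fun x y => x <= y).
Definition hlt : hyper R -> hyper R -> Prop := hrel (fun x y => x < y).
Definition hnorm : hyper R -> hyper R := hmap (fun x => `|x|).

Definition infinitesimal (x : hyper R) : Prop :=
  forall e : R, 0 < e -> hlt (hnorm x) (std e).

Definition infinite (x : hyper R) : Prop := forall c : R, hlt (std c) (hnorm x).

(* Infinitesimals are realized as 0 and infinities, of either sign, as a single
   infinity, written +oo; finite non-infinitesimal numbers are not realized. *)
Definition realizes (x : hyper R) (v : \bar R) : Prop :=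
  (infinitesimal x /\ v = 0%E) \/ (infinite x /\ v = +oo%E).

(* The hyperfinite sum a_N + ... + a_M, both ends included. *)
Definition hsum a (N M : hyper nat) : hyper R :=
  hmap2 (fun n m => \sum_(n <= k < m.+1) a k) N M.

Definition converges_at_infinity a : Prop :=
  forall N M, infinite_index N -> infinite_index M -> hleqn N M ->
    realizes (hsum a N M) 0%E.

(* The upper end has to be taken large enough depending on the lower one: for
   the harmonic series, say, the sum from N to N + 1 is infinitesimal. *)
Definition diverges_at_infinity a : Prop :=
  forall N, infinite_index N ->
    exists M, [/\ infinite_index M, hleqn N M & realizes (hsum a N M) +oo%E].

Definition csum_value a (v : \bar R) : Prop :=
  (v = 0%E /\ converges_at_infinity a) \/ (v = +oo%E /\ diverges_at_infinity a).

Definition convergence_sum a : Prop := exists v, csum_value a v.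

Lemma infinitesimal_not_infinite (x : hyper R) : infinitesimal x -> ~ infinite x.
Proof.
move=> /(_ 1 ltr01) x1 /(_ 1) x2.
rewrite -(hreprK (hnorm x)) in x1 x2.
move/hrelE: x1 => x1; move/hrelE: x2 => x2.
have : \forall i \near ultra_sets U, False.
  by apply: filterS2 x1 x2 => i /lt_trans h /h; rewrite ltxx.
by move=> /filter_ex[].
Qed.

Lemma csum_value_unique a v w : csum_value a v -> csum_value a w -> v = w.
Proof.
have excl : converges_at_infinity a -> ~ diverges_at_infinity a.
  move=> ca da; have [N NN] := infinite_index_exists.
  have [M [MM NM]] := da _ NN; have := ca _ _ NN MM NM.
  by move=> [[x0 _]|[]//] [[]//|[/(infinitesimal_not_infinite x0)]].
move=> [[-> ca]|[-> da]] [[-> ca']|[-> da']] //.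
- by case: (excl ca).
- by case: (excl ca').
Qed.

Definition partial_sum a (n : nat) : R := \sum_(1 <= k < n.+1) a k.

Definition monotonic_at_infinity a : Prop :=
  (forall N M, infinite_index N -> infinite_index M -> hleqn N M ->
     hle (hmap (partial_sum a) N) (hmap (partial_sum a) M)) \/
  (forall N M, infinite_index N -> infinite_index M -> hleqn N M ->
     hle (hmap (partial_sum a) M) (hmap (partial_sum a) N)).

(* All conditions are imposed at infinite indices n only, so tau may be
   arbitrary on an initial segment. *)
Definition contiguous_rearrangement_at_infinity a b : Prop :=
  exists tau : nat -> nat, forall N, infinite_index N ->
    [/\ hleqn (std 1%N) (hmap tau N),
        hltn (hmap tau N) (hmap tau (hsucc N)) &
        hmap b N = hmap2 (fun p q => \sum_(p <= k < q) a k)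
                         (hmap tau N) (hmap tau (hsucc N))].

End Reals.
End Ultrapower.

(* Main.v *)
Require Import Defs.
From mathcomp Require Import all_boot all_order all_algebra.
From mathcomp Require Import all_classical all_reals all_analysis.

(** A property that holds at all infinite indices holds at all sufficiently
    large standard ones, so [tau] is eventually strictly increasing, the terms
    of [a] eventually have a constant sign, and the sum of [b] from [N] to [M]
    is the sum of [a] from [tau N] to [tau (M + 1) - 1].  Convergence is thus
    the Cauchy criterion for [a], restricted to the blocks.  For divergence,
    the sum of [a] from [tau N] to a suitable [M] is infinite, and since all
    terms have the same sign, extending it to the end of a block beyond [M]
    cannot decrease its absolute value. *)

Set Implicit Arguments.
Unset Strict Implicit.
Unset Printing Implicit Defensive.

Import Order.TTheory GRing.Theory Num.Theory.

Local Open Scope classical_set_scope.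
Local Open Scope ring_scope.

Section Transfer.
Context (U : free_ultrafilter).

Lemma infinite_index_hclass (f : nat -> nat) :
  infinite_index (hclass U f) <->
  forall k, \forall i \near ultra_sets U, (k <= f i)%N.
Proof.
split=> h k; first by have /hrelE := h k.
by apply/hrelE; apply: h.
Qed.

(* If [P] fails at some [x k] with [k <= s (x k)] for every [k], then the
   sequence [x] is a point of infinite size where the extension of [P] fails. *)
Lemma underflow (T : Type) (s : T -> nat) (P : T -> Prop) :
  (forall x : nat -> T, infinite_index (hclass U (s \o x)) ->
     \forall i \near ultra_sets U, P (x i)) ->
  exists n0, forall x, (n0 <= s x)%N -> P x.
Proof.
move=> hP; apply: contrapT => nP.
have ex_bad k : exists x, (k <= s x)%N /\ ~ P x.
  apply: contrapT => /forallNP nx; apply: nP; exists k => x kx.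
  by apply: contrapT => nPx; apply: (nx x).
have [x xP] := choice ex_bad.
have /filter_ex[i Pxi] : \forall i \near ultra_sets U, P (x i).
  apply: hP; apply/infinite_index_hclass => k; apply: (@ultra_free U).
  by exists k => // i /= ki; apply: leq_trans ki (xP i).1.
exact: (xP i).2 Pxi.
Qed.

Lemma infinite_index_comp (t : nat -> nat) (f : nat -> nat) :
  (forall k, exists n0, forall n, (n0 <= n)%N -> (k <= t n)%N) ->
  infinite_index (hclass U f) -> infinite_index (hclass U (t \o f)).
Proof.
move=> ht /infinite_index_hclass hf; apply/infinite_index_hclass => k.
have [n0 n0P] := ht k; apply: filterS (hf n0) => i; exact: n0P.
Qed.

Context (R : realType).
Implicit Types (a b : nat -> R) (f g : nat -> nat) (u : nat -> R).

Lemma infinitesimal_hclass u : infinitesimal (hclass U u) <->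
  forall e, 0 < e -> \forall i \near ultra_sets U, `|u i| < e.
Proof.
rewrite /infinitesimal /hnorm hmapE; split=> h e e0.
  by have /hrelE := h e e0.
by apply/hrelE; apply: h.
Qed.

Lemma infinite_hclass u : infinite (hclass U u) <->
  forall c, \forall i \near ultra_sets U, c < `|u i|.
Proof.
rewrite /infinite /hnorm hmapE; split=> h c; first by have /hrelE := h c.
by apply/hrelE; apply: h.
Qed.

Lemma realizes0 (x : hyper U R) : realizes x 0%E <-> infinitesimal x.
Proof. by split=> [[[]//|[_ //]]|h]; left. Qed.

Lemma realizesy (x : hyper U R) : realizes x +oo%E <-> infinite x.
Proof. by split=> [[[_ //]|[]//]|h]; right. Qed.

Lemma hsumE a f g :
  hsum a (hclass U f) (hclass U g) =
  hclass U (fun i => \sum_(f i <= k < (g i).+1) a k).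
Proof. exact: hmap2E. Qed.

Lemma converges_at_infinityP a : converges_at_infinity U a <->
  forall e, 0 < e -> exists n0, forall n m, (n0 <= n)%N -> (n <= m)%N ->
    `|\sum_(n <= k < m.+1) a k| < e.
Proof.
split=> [ca e e0|ca N M].
  (* A range is encoded as a pair of its start and its length, so that the constraint [n <= m] is
     built in and the size of a pair is its start alone. *)
  have [|n0 n0P] := @underflow _ (@fst nat nat)
    (fun x => `|\sum_(x.1 <= k < (x.1 + x.2).+1) a k| < e).
    move=> x xoo.
    have /infinite_index_hclass xk := xoo.
    have := ca (hclass U (fst \o x)) (hclass U (fun i => (x i).1 + (x i).2)%N) xoo.
    case.
    - apply/infinite_index_hclass => k; apply: filterS (xk k) => i /= h.
      exact: leq_trans h (leq_addr _ _).
    - by apply/hrelE; apply: nearW => i; apply: leq_addr.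
    - by case=> + _; rewrite hsumE => /infinitesimal_hclass; apply.
    - by case.
  exists n0 => n m n0n nm; have := n0P (n, m - n)%N n0n.
  by rewrite /= subnKC.
rewrite -[N]hreprK -[M]hreprK => /infinite_index_hclass Noo _ /hrelE NM.
apply/realizes0; rewrite hsumE; apply/infinitesimal_hclass => e e0.
have [n0 n0P] := ca e e0.
apply: filterS2 (Noo n0) NM => i; exact: n0P.
Qed.

(** The partial sums at an infinite index and at its successor differ by a single term, so
    monotonicity fixes the sign of that term; [underflow] carries this down to standard indices. *)
Lemma monotonic_at_infinity_sign a : monotonic_at_infinity U a ->
  exists n0, (forall n, (n0 <= n)%N -> 0 <= a n) \/
             (forall n, (n0 <= n)%N -> a n <= 0).
Proof.
have step n : partial_sum a n.+1 = partial_sum a n + a n.+1.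
  by rewrite /partial_sum big_nat_recr.
have succ_oo f : infinite_index (hclass U f) ->
    infinite_index (hclass U (S \o f)).
  by apply: infinite_index_comp => k; exists k => n /leqW.
have le_succ f : hleqn (hclass U f) (hclass U (S \o f)).
  by apply/hrelE; apply: nearW => i /=.
case=> mono.
  have [|n0 n0P] := @underflow _ id (fun n => 0 <= a n.+1).
    move=> f foo; have := mono _ _ foo (succ_oo _ foo) (le_succ f).
    by rewrite !hmapE => /hrelE; apply: filterS => i /=; rewrite step lerDl.
  (* [n0] bounds the index [n] of [a n.+1], hence the shift; index [0] lies below the new bound. *)
  by exists n0.+1; left=> -[//|n]; exact: n0P.
have [|n0 n0P] := @underflow _ id (fun n => a n.+1 <= 0).
  move=> f foo; have := mono _ _ foo (succ_oo _ foo) (le_succ f).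
  by rewrite !hmapE => /hrelE; apply: filterS => i /=; rewrite step gerDl.
by exists n0.+1; right=> -[//|n]; exact: n0P.
Qed.

(** Beyond [n0] nothing cancels: the sum from [q] to [r] has the same sign as the one from [p] to
    [q]. *)
Lemma ler_norm_sum_nat a n0 :
  (forall n, (n0 <= n)%N -> 0 <= a n) \/ (forall n, (n0 <= n)%N -> a n <= 0) ->
  forall p q r, (n0 <= p)%N -> (p <= q)%N -> (q <= r)%N ->
  `|\sum_(p <= k < q) a k| <= `|\sum_(p <= k < r) a k|.
Proof.
move=> sgn p q r n0p pq qr; rewrite (big_cat_nat pq qr) /=.
case: sgn => sgn.
  have ge0 m l : (n0 <= m)%N -> 0 <= \sum_(m <= k < l) a k.
    move=> n0m; rewrite big_nat_cond; apply: sumr_ge0 => k.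
    by rewrite andbT => /andP[mk _]; apply/sgn/(leq_trans n0m).
  have n0q := leq_trans n0p pq.
  by rewrite !ger0_norm ?addr_ge0 ?ge0 // lerDl ge0.
have le0 m l : (n0 <= m)%N -> \sum_(m <= k < l) a k <= 0.
  move=> n0m; rewrite big_nat_cond; apply: sumr_le0 => k.
  by rewrite andbT => /andP[mk _]; apply/sgn/(leq_trans n0m).
have n0q := leq_trans n0p pq.
have leD0 : \sum_(p <= k < q) a k + \sum_(q <= k < r) a k <= 0.
  by rewrite -[leRHS]addr0 lerD ?le0.
by rewrite !ler0_norm ?le0 // lerN2 gerDl le0.
Qed.

Lemma contiguous_rearrangement_eventually a b :
  contiguous_rearrangement_at_infinity U a b ->
  exists (tau : nat -> nat) (n0 : nat), forall n, (n0 <= n)%N ->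
    (tau n < tau n.+1)%N /\ b n = \sum_(tau n <= k < tau n.+1) a k.
Proof.
case=> tau htau; exists tau.
apply: (@underflow _ id (fun n => (tau n < tau n.+1)%N /\
   b n = \sum_(tau n <= k < tau n.+1) a k)) => f foo.
have [_] := htau _ foo.
rewrite /hsucc !hmapE hmap2E => /hrelE tlt /hclass_eqP bE.
exact: filterS2 tlt bE.
Qed.

Section Blocks.
Context (a b : nat -> R) (tau : nat -> nat) (n0 : nat)
  (tauP : forall n, (n0 <= n)%N ->
    (tau n < tau n.+1)%N /\ b n = \sum_(tau n <= k < tau n.+1) a k).

(** Each step raises the natural number [tau n] by at least one. This linear growth shows how far
    the blocks reach. *)
Lemma tau_addl n d : (n0 <= n)%N -> (tau n + d <= tau (n + d))%N.
Proof.
move=> n0n; elim: d => [|d IH]; first by rewrite !addn0.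
rewrite !addnS; apply: leq_ltn_trans IH (tauP _).1.
exact: leq_trans n0n (leq_addr _ _).
Qed.

Lemma tau_unbounded k : exists m0, forall n, (m0 <= n)%N -> (k <= tau n)%N.
Proof.
exists (n0 + k)%N => n h; have n0n := leq_trans (leq_addr _ _) h.
have := tau_addl (n - n0) (leqnn n0); rewrite subnKC //; apply: leq_trans.
by apply: leq_trans (leq_addl _ _); rewrite leq_subRL.
Qed.

(** Consecutive blocks abut, each one starting where the previous one stops. *)
Lemma sum_blocks n m : (n0 <= n)%N -> (n <= m)%N ->
  \sum_(n <= j < m) b j = \sum_(tau n <= k < tau m) a k.
Proof.
move=> n0n /subnKC <-; elim: (m - n)%N => [|d IH].
  by rewrite addn0 !big_geq.
have n0nd : (n0 <= n + d)%N := leq_trans n0n (leq_addr _ _).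
have [ltt bE] := tauP n0nd.
have le_tau := leq_trans (leq_addr _ _) (tau_addl d n0n).
rewrite addnS big_nat_recr ?leq_addr //= IH bE.
by rewrite (big_cat_nat le_tau (ltnW ltt)).
Qed.

Lemma converges_blocks : converges_at_infinity U a -> converges_at_infinity U b.
Proof.
move=> /converges_at_infinityP ca; apply/converges_at_infinityP => e /ca[m0 m0P].
have [m1 m1P] := tau_unbounded m0.
exists (maxn n0 m1) => n m; rewrite geq_max => /andP[n0n m1n] nm.
(* Strictness makes [tau m.+1] a successor; its predecessor is the last index of the range, which
   the Cauchy criterion includes. *)
have lttau : (tau n < tau m.+1)%N.
  have := tau_addl (m.+1 - n) n0n; rewrite subnKC ?(leqW nm) //.
  by apply: leq_trans; rewrite subSn // addnS ltnS leq_addr.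
rewrite sum_blocks ?(leqW nm) // -(ltn_predK lttau).
by apply: m0P (m1P _ m1n) _; rewrite -ltnS (ltn_predK lttau).
Qed.

Lemma diverges_blocks s :
  (forall n, (s <= n)%N -> 0 <= a n) \/ (forall n, (s <= n)%N -> a n <= 0) ->
  diverges_at_infinity U a -> diverges_at_infinity U b.
Proof.
move=> sgn da N; rewrite -[N]hreprK; set f := hrepr N => foo.
have tfoo := infinite_index_comp tau_unbounded foo.
have [M] := da _ tfoo; rewrite -[M]hreprK; set g := hrepr M.
rewrite hsumE => -[_ /hrelE tfg /realizesy /infinite_hclass sum_oo].
move/infinite_index_hclass: (foo) => fk; move/infinite_index_hclass: tfoo => tfk.
(* Adding [f] keeps the upper end above the lower one, and [tau (h i).+1] is at least
   [tau (f i) + (g i).+1], so the blocks up to [h i] cover all terms up to [g i]. *)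
pose h i := (f i + g i)%N.
have fh i : (f i <= h i)%N by apply: leq_addr.
exists (hclass U h); split.
- by apply/infinite_index_hclass => k; apply: filterS (fk k) => i /leq_trans; apply.
- by apply/hrelE; apply: nearW.
apply/realizesy; rewrite hsumE; apply/infinite_hclass => c.
near=> i.
have n0f : (n0 <= f i)%N by near: i; apply: fk.
have stf : (s <= tau (f i))%N by near: i; apply: tfk.
have tfgi : (tau (f i) <= g i)%N by near: i; exact: tfg.
rewrite sum_blocks ?(leqW (fh i)) //.
apply: (@lt_le_trans _ _ `|\sum_(tau (f i) <= k < (g i).+1) a k|).
  by near: i; apply: sum_oo.
apply: (ler_norm_sum_nat sgn) => //; first exact: leqW.
rewrite /h -addnS; apply: leq_trans (tau_addl _ n0f); exact: leq_addl.
Unshelve. all: by end_near. Qed.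

End Blocks.

End Transfer.

Theorem theorem4p1 (U : free_ultrafilter) (R : realType) (a b : nat -> R) :
  contiguous_rearrangement_at_infinity U a b ->
  monotonic_at_infinity U a ->
  convergence_sum U a ->
  exists v : \bar R, csum_value U a v /\ csum_value U b v.
Proof.
move=> /contiguous_rearrangement_eventually[tau [n0 tauP]].
move=> /monotonic_at_infinity_sign[s sgn] [v va]; exists v; split=> //.
case: va => [[-> ca]|[-> da]]; [left|right]; split=> //.
- exact: (converges_blocks tauP).
- exact: (diverges_blocks tauP sgn).
Qed.
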